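(* Under the market maker's belief $\widetilde W$, the price impact of marginal order flow for $x_j$ on the price of another claim $x_i$, given realized aggregate order flow $\omega$, is $$\frac{\partial}{\partial W(x_j)}P(x_i,\omega;\widetilde W)=\frac1{\sigma_j^2}\operatorname{Cov}\big(\eta(x_i\mid\cdot),\,\widetilde W(x_j\mid\cdot)\,\big|\,\omega\big).$$ Averaging over the distribution of realized order flow gives the expected cross-impact $$\frac{\partial}{\partial W(x_j)}\overline P(x_i,W;\widetilde W)=\mathbb E^{\mathbb P_W}\Big[\frac{\partial}{\partial W(x_j)}P(x_i,\omega;\widetilde W)\Big].$$
   Context: Setting. $X=\{x_1,x_2,\dots\}$ is a countable (finite or infinite) set of states; $S=\{s_1,\dots,s_K\}$ a finite set of signals with prior $\pi_0$; for each $k$, $\eta(\cdot\mid s_k)$ is a probability mass function on $X$. $\sigma_i>0$; noise trades $\varepsilon_i\sim\mathcal N(0,\sigma_i^2)$ are independent. When the insider submits portfolio $W\colon X\to\mathbb R$, order flow is $\omega_i=W(x_i)+\varepsilon_i$, and $\mathbb P_W$ is the law of $\omega=(\omega_i)$; $\partial/\partial W(x_j)$ is the derivative with respect to the insider's order in claim $x_j$ (holding noise trades fixed in the first formula, i.e. the derivative of the price with respect to the coordinate $\omega_j$). Portfolios $W$ and believed demands $\widetilde W(\cdot\mid s_l)$ satisfy $\sum_i W(x_i)^2/\sigma_i^2<\infty$. The market maker holds belief $\widetilde W(\cdot\mid\cdot)\colon X\times S\to\mathbb R$ and has posterior $$\pi_1(s_l\mid\omega;\widetilde W)\propto\exp\Big(\sum_i\tfrac{\widetilde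 W(x_i\mid s_l)\omega_i}{\sigma_i^2}-\tfrac12\sum_i\tfrac{\widetilde W(x_i\mid s_l)^2}{\sigma_i^2}\Big)\pi_0(s_l).$$ Prices: $P(x_i,\omega;\widetilde W)=\sum_l\eta(x_i\mid s_l)\,\pi_1(s_l\mid\omega;\widetilde W)$, and $\overline P(x_i,W;\widetilde W)=\mathbb E^{\mathbb P_W}[P(x_i,\omega;\widetilde W)]$. For functions $f,g$ on $S$, $\operatorname{Cov}(f(\cdot),g(\cdot)\mid\omega)$ is their covariance under the posterior $\pi_1(\cdot\mid\omega;\widetilde W)$ on $S$. *)

(* Defs.v *)
From HB Require Import structures.
From mathcomp Require Import all_boot all_order all_algebra finmap.
From mathcomp Require Import all_classical all_reals all_analysis measurable_realfun.
Import Order.TTheory GRing.Theory Num.Theory.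
Import numFieldNormedType.Exports.

Set Implicit Arguments.
Unset Strict Implicit.
Unset Printing Implicit Defensive.

Local Open Scope classical_set_scope.
Local Open Scope ring_scope.

(* A series over the countable index type X is summed along the enumeration
   x_1, x_2, ... given by its countType structure: pickle_inv hits every x : X
   exactly once, and the indices it does not use contribute 0. This covers
   finite and infinite X at once. *)
Definition enum_series (R : realType) (X : countType) (f : X -> R) : R^nat :=
  fun n => \sum_(0 <= k < n) oapp f 0 (@pickle_inv X k).

Definition enum_sum (R : realType) (X : countType) (f : X -> R) : R :=
  limn (enum_series f).

(* Square-integrability of a portfolio relative to the noise variances. *)
Definition finite_energy (R : realType) (X : countType) (sigma : X -> R)
    (W : X -> R) : Prop :=
  (\esum_(x in [set: X]) (W x ^+ 2 / sigma x ^+ 2)%:E < +oo)%E.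

Section noise_trades.
Context (R : realType) (d : measure_display) (T : measurableType d)
  (P : probability T R) (X : countType).
Implicit Type eps : X -> {RV P >-> R}.

Definition mutually_independent eps : Prop :=
  forall (F : {fset X}) (B : X -> set R),
    (forall x, x \in F -> measurable (B x)) ->
    P (\bigcap_(x in [set` F]) (eps x @^-1` B x)) =
    (\prod_(x <- F) P (eps x @^-1` B x))%E.

(* normal_prob m s is parameterized by the standard deviation s. *)
Definition gaussian_noise (sigma : X -> R) eps : Prop :=
  mutually_independent eps /\
  forall (x : X) (B : set R), measurable B ->
    distribution P (eps x) B = normal_prob 0 (sigma x) B.

End noise_trades.

Section order_flow_space.
Context (R : realType) (X : countType).

Definition cylinders : set (set (X -> R)) :=
  [set C | exists (x : X) (B : set R),
     measurable B /\ C = (fun w : X -> R => w x) @^-1` B].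

(* X -> R with the product sigma-algebra. *)
Definition flow_space := g_sigma_algebraType cylinders.

End order_flow_space.
Arguments cylinders : clear implicits.

HB.instance Definition _ (R : realType) (X : countType) :=
  Measurable.on (flow_space R X).

Section order_flow.
Context (R : realType) (d : measure_display) (T : measurableType d)
  (P : probability T R) (X : countType).
Variables (eps : X -> {RV P >-> R}) (W : X -> R).

Definition order_flow : T -> flow_space R X := fun t x => W x + eps x t.

Lemma measurable_order_flow : measurable_fun [set: T] order_flow.
Proof.
apply: (@measurability _ _ T (flow_space R X) setT order_flow
  (cylinders R X) erefl).
move=> _ [_ [x [B [mB ->]]] <-].
suff mf : measurable_fun [set: T] (fun t => W x + eps x t) by exact: mf.
exact: measurable_funD.
Qed.

HB.instance Definition _ := isMeasurableFun.Build _ _ _ _ order_flow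
  measurable_order_flow.

Definition flow_law := distribution P order_flow.

HB.instance Definition _ := Probability.on flow_law.

End order_flow.

Section prices.
Context (R : realType) (X : countType) (S : finType).
Variables (sigma : X -> R) (pi0 : S -> R) (eta Wt : X -> S -> R).
Implicit Types (w : X -> R) (f g : S -> R).

(* The order flows at which the posterior below is defined: elsewhere, the
   enum_sum in log_likelihood has an arbitrary value. *)
Definition posterior_defined w : Prop :=
  forall s, cvgn (enum_series (fun x => Wt x s * w x / sigma x ^+ 2)).

Definition log_likelihood (s : S) w : R :=
  enum_sum (fun x => Wt x s * w x / sigma x ^+ 2)
  - 2^-1 * enum_sum (fun x => Wt x s ^+ 2 / sigma x ^+ 2).

Definition posterior_weight (s : S) w : R :=
  expR (log_likelihood s w) * pi0 s.

Definition posterior (s : S) w : R :=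
  posterior_weight s w / \sum_s' posterior_weight s' w.

Definition posterior_mean f w : R := \sum_s f s * posterior s w.

Definition posterior_cov f g w : R :=
  posterior_mean (fun s =>
    (f s - posterior_mean f w) * (g s - posterior_mean g w)) w.

Definition price (x : X) w : R := \sum_s eta x s * posterior s w.

(* The derivative of the price of x with respect to the coordinate w j. *)
Definition price_impact (j x : X) w : R :=
  'D_1 (fun t : R => price x [eta w with j |-> t]) (w j).

End prices.

Section expected_prices.
Context (R : realType) (d : measure_display) (T : measurableType d)
  (P : probability T R) (X : countType) (S : finType).
Variables (eps : X -> {RV P >-> R}) (sigma : X -> R) (pi0 : S -> R).
Variables (eta Wt : X -> S -> R).

Definition expected_price (x : X) (W : X -> R) : R :=
  fine 'E_(flow_law eps W)[price sigma pi0 eta Wt x].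

End expected_prices.

(* Main.v *)
Require Import Defs.
From HB Require Import structures.
From mathcomp Require Import all_boot all_order all_algebra finmap.
From mathcomp Require Import all_classical all_reals all_analysis measurable_realfun.
From mathcomp Require Import ring lra.
Import Order.TTheory GRing.Theory Num.Theory.
Import numFieldNormedType.Exports.

Local Open Scope classical_set_scope.
Local Open Scope ring_scope.

(** Moving one coordinate of the order flow multiplies the posterior weight of
    each signal by an exponential, so the posterior is a softmax whose derivative
    is a covariance; this derivative is bounded, which allows differentiation
    under the expectation.

    The posterior is defined almost surely because the centered Gaussian series
    converges almost surely. The law of the noise is invariant under sign changes
    of single coordinates; this replaces the martingale property in Kolmogorov's
    maximal inequality, applied to the partial sums stopped when they first exceed
    a threshold. *)

(** * Series along the enumeration of a countable type *)

Section enum_series.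
Context {R : realType} {X : countType}.
Implicit Types f g : X -> R.

Lemma enum_seriesD f g :
  enum_series (fun x => f x + g x) = enum_series f \+ enum_series g.
Proof.
apply/funext => n; rewrite /enum_series /= -big_split /=.
by apply: eq_bigr => k _; case: pickle_inv => [x|]//=; rewrite addr0.
Qed.

(** The code of [j] is the only index that contributes, so the partial sums are constantly [a]
    beyond it. *)
Lemma cvg_enum_series_point (j : X) (a : R) :
  enum_series (fun x => if x == j then a else 0) n @[n --> \oo] --> a.
Proof.
apply: cvg_near_cst; near=> n.
have jn : (choice.pickle j < n)%N by near: n; exact: nbhs_infty_gt.
apply/eqP; rewrite /enum_series (big_cat_nat (leq0n _) (ltnW jn)) /=.
rewrite big_nat big1 ?add0r; last first.
  move=> k /andP[_ kj]; case: pickle_inv (@pickle_invK X k) => //= x xk.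
  by case: eqP => // xj; move: kj; rewrite -xj xk ltnn.
rewrite big_ltn// pickleK_inv /= eqxx big_nat big1 ?addr0// => k /andP[jk _].
case: pickle_inv (@pickle_invK X k) => //= x xk.
by case: eqP => // xj; move: jk; rewrite -xj xk ltnn.
Unshelve. all: by end_near. Qed.

(** Changing one term preserves divergence as well as convergence. The equivalence is what lets
    order flows with divergent likelihood series be treated too. *)
Lemma is_cvg_enum_series_point f (j : X) (a : R) :
  cvgn (enum_series (fun x => f x + if x == j then a else 0)) <->
  cvgn (enum_series f).
Proof.
have cp b := @cvg_enum_series_point j b.
split=> [h|h]; last first.
  by rewrite enum_seriesD; apply: is_cvgD => //; apply/cvg_ex; exists a; exact: cp.
suff -> : f = (fun x => (f x + if x == j then a else 0) + if x == j then - a else 0).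
  by rewrite enum_seriesD; apply: is_cvgD => //; apply/cvg_ex; exists (- a); exact: cp.
by apply/funext => x; case: eqP; rewrite ?addrK ?addr0.
Qed.

Lemma enum_sum_point f (j : X) (a : R) : cvgn (enum_series f) ->
  enum_sum (fun x => f x + if x == j then a else 0) = enum_sum f + a.
Proof.
move=> cf; apply: cvg_lim => //; rewrite enum_seriesD.
by apply: cvgD; [exact: cf|exact: cvg_enum_series_point].
Qed.

End enum_series.

(** * Derivative of a softmax mean *)

Section softmax.
Context {R : realType} {S : finType}.

(** By the quotient rule each weight [p s] has derivative [p s * (b s - m)]. Since these derivatives
    sum to 0, [c] may be centered at its mean, which produces a covariance. *)
Lemma is_derive_softmax_mean (c a b : S -> R) (t0 : R) :
  \sum_s a s != 0 ->
  let p s := a s / \sum_s' a s' in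
  let m := \sum_s b s * p s in
  is_derive t0 1
    (fun t => \sum_s c s * (a s * expR (b s * (t - t0))
                            / \sum_s' a s' * expR (b s' * (t - t0))))
    (\sum_s (c s - \sum_s' c s' * p s') * (b s - m) * p s).
Proof.
move=> Z0 p m.
pose e s (t : R) := a s * expR (b s * (t - t0)).
have de s : is_derive t0 1 (e s) (a s * b s).
  rewrite /e; apply: is_derive_eq.
  rewrite subrr mulr0 expR0 /GRing.scale /=; ring.
have dsum (f : S -> R -> R) (df : S -> R) :
    (forall s, is_derive t0 1 (f s) (df s)) ->
    is_derive t0 1 (fun t => \sum_s f s t) (\sum_s df s).
  move=> h; rewrite -fct_sumE.
  elim/big_ind2 : _ => //=; first exact: is_derive_cst.
  by move=> x y x' y' h1 h2; exact: is_deriveD.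
have eZ : \sum_s e s t0 = \sum_s a s.
  by apply: eq_bigr => s _; rewrite /e subrr mulr0 expR0 mulr1.
have dZ := dsum e _ de.
have dV : is_derive t0 1 (fun t => (\sum_s e s t)^-1)
    (- (\sum_s a s) ^- 2 * \sum_s a s * b s).
  by rewrite -eZ; apply: (@is_deriveV R (fun t => \sum_s e s t)); rewrite ?eZ.
have sp1 : \sum_s p s = 1 by rewrite -mulr_suml divff.
have mE : (\sum_s a s)^-1 * \sum_s a s * b s = m.
  by rewrite mulr_sumr; apply: eq_bigr => s _; rewrite /p; ring.
have := dsum (fun s t => c s * (e s t / \sum_s' e s' t))
  (fun s => c s * (p s * (b s - m))).
set D := \sum_s _; have -> : D = \sum_s (c s - \sum_s' c s' * p s') * (b s - m) * p s.
  rewrite /D; under [RHS]eq_bigr do rewrite -mulrA mulrBl.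
  rewrite sumrB -mulr_sumr.
  have -> : \sum_s (b s - m) * p s = 0.
    under eq_bigr do rewrite mulrBl.
    by rewrite sumrB -mulr_sumr sp1 mulr1 subrr.
  by rewrite mulr0 subr0; apply: eq_bigr => s _; ring.
apply => s.
have := @is_deriveZ R _ _ _ (c s) _ _ _ (is_deriveM (de s) dV).
congr is_derive.
rewrite /GRing.scale /= eZ /e subrr mulr0 expR0 mulr1 /p -mE.
by congr (_ * _); field.
Qed.

Lemma norm_mean_le (p f : S -> R) (B : R) : (forall s, 0 <= p s) ->
  \sum_s p s = 1 -> (forall s, `|f s| <= B) -> `|\sum_s f s * p s| <= B.
Proof.
move=> p0 p1 fB; apply: (le_trans (ler_norm_sum _ _ _)).
rewrite -[leRHS]mulr1 -p1 mulr_sumr; apply: ler_sum => s _.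
by rewrite normrM (ger0_norm (p0 s)) ler_wpM2r.
Qed.

End softmax.

(** * Price impact as a posterior covariance, and its bounds *)

Section price_calculus.
Context {R : realType} {X : countType} {S : finType}.
Variables (sigma : X -> R) (pi0 : S -> R) (eta Wt : X -> S -> R).
Hypotheses (pi0_ge0 : forall s, 0 <= pi0 s) (pi0_sum1 : \sum_s pi0 s = 1).
Implicit Type w : X -> R.

Let loglik_series (s : S) w := enum_series (fun x => Wt x s * w x / sigma x ^+ 2).

(* The slope is 0 where the series diverges, because there the junk value of
   the log-likelihood does not depend on any single coordinate. *)
Definition loglik_slope (j : X) (s : S) w : R :=
  if `[< cvgn (loglik_series s w) >] then Wt j s / sigma j ^+ 2 else 0.

(** The series is linear in [w] and only its term at [j] moves. If it diverges, it diverges after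
    the update too, and both limits take the same default value. *)
Lemma log_likelihood_update (j : X) (s : S) w (t : R) :
  log_likelihood sigma Wt s [eta w with j |-> t] =
  log_likelihood sigma Wt s w + loglik_slope j s w * (t - w j).
Proof.
rewrite /log_likelihood addrAC; congr (_ - _).
have E : (fun x => Wt x s * [eta w with j |-> t] x / sigma x ^+ 2) =
    (fun x => Wt x s * w x / sigma x ^+ 2
      + if x == j then Wt j s / sigma j ^+ 2 * (t - w j) else 0).
  by apply/funext => x /=; case: eqP => [->|_]; rewrite ?addr0//; ring.
rewrite E /loglik_slope; case: asboolP => h; first by rewrite enum_sum_point.
rewrite /enum_sum mul0r addr0 (dvgP h); apply: dvgP.
by apply: contra_not h => /is_cvg_enum_series_point.
Qed.

Lemma posterior_weight_ge0 s w : 0 <= posterior_weight sigma pi0 Wt s w.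
Proof. by rewrite mulr_ge0 ?expR_ge0. Qed.

Lemma sum_posterior_weight_gt0 w : 0 < \sum_s posterior_weight sigma pi0 Wt s w.
Proof.
rewrite lt_neqAle sumr_ge0 ?andbT; last by move=> s _; exact: posterior_weight_ge0.
rewrite eq_sym psumr_neq0; last by move=> s _; exact: posterior_weight_ge0.
have : \sum_s pi0 s != 0 by rewrite pi0_sum1 oner_neq0.
rewrite psumr_neq0// => /hasP[s sS /= s0].
by apply/hasP; exists s => //=; rewrite mulr_gt0 ?expR_gt0.
Qed.

Lemma posterior_ge0 s w : 0 <= posterior sigma pi0 Wt s w.
Proof.
by rewrite divr_ge0 ?posterior_weight_ge0// ltW// sum_posterior_weight_gt0.
Qed.

Lemma sum_posterior w : \sum_s posterior sigma pi0 Wt s w = 1.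
Proof. by rewrite -mulr_suml divff// gt_eqF// sum_posterior_weight_gt0. Qed.

(** Valid at every [w], since [loglik_slope] absorbs the divergent case; later integrals can thus
    range over the whole space without an exceptional set. *)
Lemma is_derive_price (i j : X) w :
  is_derive (w j) 1
    (fun t : R => price sigma pi0 eta Wt i [eta w with j |-> t])
    (posterior_cov sigma pi0 Wt (eta i) (loglik_slope j ^~ w) w).
Proof.
have := is_derive_softmax_mean (eta i)
  (fun s => posterior_weight sigma pi0 Wt s w) (loglik_slope j ^~ w) (w j).
have wE s t : posterior_weight sigma pi0 Wt s [eta w with j |-> t] =
    posterior_weight sigma pi0 Wt s w * expR (loglik_slope j s w * (t - w j)).
  by rewrite /posterior_weight log_likelihood_update expRD mulrAC.
move=> /(_ _)/=; rewrite gt_eqF ?sum_posterior_weight_gt0// => /(_ isT).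
congr is_derive; apply/funext => t; apply: eq_bigr => s _; congr (_ * _).
by rewrite /posterior wE; congr (_ / _); apply: eq_bigr => s' _; rewrite wE.
Qed.

Lemma price_impactE (i j : X) w : price_impact sigma pi0 eta Wt j i w =
  posterior_cov sigma pi0 Wt (eta i) (loglik_slope j ^~ w) w.
Proof. by rewrite /price_impact; have [_ ->] := is_derive_price i j w. Qed.

Lemma norm_posterior_mean_le (f : S -> R) (B : R) w : (forall s, `|f s| <= B) ->
  `|posterior_mean sigma pi0 Wt f w| <= B.
Proof.
move=> fB; apply: norm_mean_le => // [s|]; [exact: posterior_ge0|].
exact: sum_posterior.
Qed.

Lemma norm_posterior_cov_le (f g : S -> R) (A B : R) w :
  (forall s, `|f s| <= A) -> (forall s, `|g s| <= B) ->
  `|posterior_cov sigma pi0 Wt f g w| <= (A + A) * (B + B).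
Proof.
move=> fA gB; apply: norm_posterior_mean_le => s; rewrite normrM.
apply: ler_pM => //.
- by apply: (le_trans (ler_normB _ _)); rewrite lerD// norm_posterior_mean_le.
- by apply: (le_trans (ler_normB _ _)); rewrite lerD// norm_posterior_mean_le.
Qed.

(** A constant independent of [w]: centering at most doubles a bound, and sums of absolute values
    stand in for maxima over [S]. *)
Definition price_impact_bound (i j : X) : R :=
  let A := \sum_s `|eta i s| in
  let B := \sum_s `|Wt j s / sigma j ^+ 2| in (A + A) * (B + B).

Lemma price_impact_le (i j : X) w :
  `|price_impact sigma pi0 eta Wt j i w| <= price_impact_bound i j.
Proof.
have le_sum_norm (f : S -> R) s : `|f s| <= \sum_s' `|f s'|.
  by rewrite (bigD1 s)//= lerDl sumr_ge0.
rewrite price_impactE; apply: norm_posterior_cov_le => s; first exact: le_sum_norm.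
apply: le_trans (le_sum_norm _ s); rewrite /loglik_slope.
by case: ifP => // _; rewrite normr0.
Qed.

Lemma price_le (i : X) w :
  `|price sigma pi0 eta Wt i w| <= \sum_s `|eta i s|.
Proof.
by apply: norm_posterior_mean_le => s; rewrite (bigD1 s)//= lerDl sumr_ge0.
Qed.

(** Where all the series converge, every slope is [Wt j s / sigma j ^+ 2], and the common factor
    leaves the covariance by linearity. *)
Lemma is_derive_price_defined (i j : X) w : posterior_defined sigma Wt w ->
  is_derive (w j) 1
    (fun t : R => price sigma pi0 eta Wt i [eta w with j |-> t])
    ((sigma j ^+ 2)^-1 * posterior_cov sigma pi0 Wt (eta i) (Wt j) w).
Proof.
move=> dw; have := is_derive_price i j w; congr is_derive.
have slopeE s : loglik_slope j s w = (sigma j ^+ 2)^-1 * Wt j s.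
  by rewrite /loglik_slope (asboolT (dw s)) mulrC.
have meanE : posterior_mean sigma pi0 Wt (loglik_slope j ^~ w) w =
    (sigma j ^+ 2)^-1 * posterior_mean sigma pi0 Wt (Wt j) w.
  by rewrite mulr_sumr; apply: eq_bigr => s _; rewrite slopeE; ring.
rewrite /posterior_cov meanE [RHS]mulr_sumr.
by apply: eq_bigr => s _; rewrite slopeE; ring.
Qed.

End price_calculus.

(** * Measurability of convergence sets and of limits *)

Section measurable_limits.
Context {R : realType}.

(** The Cauchy criterion with countable quantifiers only, so that the set of convergence is built by
    countable unions and intersections. *)
Lemma cvgn_cauchyP (u : R^nat) : cvgn u <->
  forall p : nat, exists N, forall n, `|u (N + n)%N - u N| < p.+1%:R^-1.
Proof.
split=> [/cauchy_cvgP/cauchy_ballP cu p|h].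
  have p0 : 0 < (p.+1%:R^-1 : R) by rewrite invr_gt0.
  have [[A B] /= [[N _ NA] [M _ MB]] AB] := cu _ p0.
  exists (maxn N M) => n.
  have := AB (u (maxn N M), u (maxn N M + n)%N); rewrite /ball /= distrC; apply.
  split; first by apply: NA => /=; rewrite leq_maxl.
  by apply: MB => /=; rewrite (leq_trans (leq_maxr N M)) ?leq_addr.
apply/cauchy_cvgP/cauchy_exP => e e0.
have [p pe] := ltr_add_invr (y := 0) (x := e) e0.
rewrite add0r in pe; have [N hN] := h p; exists (u N); exists N => // n /= Nn.
by rewrite /ball /= distrC -(subnKC Nn); exact: lt_trans (hN _) pe.
Qed.

Context {d : measure_display} {T : measurableType d}.
Variable h : (T -> R)^nat.
Hypothesis mh : forall n, measurable_fun setT (h n).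

Lemma measurable_cvgn : measurable [set t | cvgn (h ^~ t)].
Proof.
have -> : [set t | cvgn (h ^~ t)] = \bigcap_p \bigcup_N \bigcap_n
    [set t | `|h (N + n)%N t - h N t| < p.+1%:R^-1].
  apply/seteqP; split => t /=.
    by move=> /cvgn_cauchyP ct p _; have [N hN] := ct p; exists N => // n _; exact: hN.
  move=> ct; apply/cvgn_cauchyP => p; have [N _ hN] := ct p I.
  by exists N => n; exact: hN.
apply: bigcapT_measurable => p; apply: bigcupT_measurable => N.
apply: bigcapT_measurable => n.
have mlt : measurable_fun setT (fun t => `|h (N + n)%N t - h N t| < p.+1%:R^-1).
  by apply: measurable_fun_ltr => //; apply: measurableT_comp => //; apply: measurable_funB.
by have := mlt measurableT [set true] I; rewrite setTI.
Qed.

(** Off the measurable set of convergence the limit is the constant [point], so the two pieces can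
    be glued. *)
Lemma measurable_fun_limn : measurable_fun setT (fun t => limn (h ^~ t)).
Proof.
have mC := measurable_cvgn.
have -> : (fun t => limn (h ^~ t)) =
    (fun t => if t \in [set t | cvgn (h ^~ t)] then limn (h ^~ t) else point).
  by apply/funext => t; case: ifPn => //; rewrite notin_setE => /dvgP.
apply: measurable_fun_if => //.
- by apply: (@measurable_fun_bool _ _ _ _ true); rewrite setTI preimage_mem_true.
- rewrite setTI preimage_mem_true; apply: (@measurable_fun_cvg _ _ _ _ h) => //.
  by move=> n; exact: measurable_funTS.
Qed.

End measurable_limits.

(** * Measurability of prices and price impacts *)

Section measurable_prices.
Context {R : realType} {X : countType}.

Lemma measurable_coordinate (x : X) :
  measurable_fun setT (fun w : flow_space R X => w x).
Proof.
move=> _ B mB; rewrite setTI.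
by apply: sub_sigma_algebra; exists x, B.
Qed.

Lemma measurable_enum_series (a s : X -> R) (n : nat) :
  measurable_fun setT (fun w : flow_space R X =>
    enum_series (fun x => a x * w x / s x) n).
Proof.
apply: measurable_sum => k; case: pickle_inv => [x|] //=.
by apply: measurable_funM => //; apply: measurable_funM => //; exact: measurable_coordinate.
Qed.

Context {S : finType}.
Variables (sigma : X -> R) (pi0 : S -> R) (eta Wt : X -> S -> R).
Hypotheses (pi0_ge0 : forall s, 0 <= pi0 s) (pi0_sum1 : \sum_s pi0 s = 1).

Lemma measurable_posterior_defined :
  measurable [set w : flow_space R X | posterior_defined sigma Wt w].
Proof.
rewrite [X in measurable X](_ : _ = \bigcap_(s in [set: S])
    [set w | cvgn (enum_series (fun x => Wt x s * w x / sigma x ^+ 2))]).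
  apply: fin_bigcap_measurable => [|s _]; first exact: finite_finset.
  by apply: measurable_cvgn => n; exact: measurable_enum_series.
by apply/seteqP; split => w /= h s => [_|]; exact: h.
Qed.

Lemma measurable_log_likelihood (s : S) :
  measurable_fun setT (log_likelihood sigma Wt s : flow_space R X -> R).
Proof.
apply: measurable_funB => //.
by apply: measurable_fun_limn => n; exact: measurable_enum_series.
Qed.

Lemma measurable_posterior (s : S) :
  measurable_fun setT (posterior sigma pi0 Wt s : flow_space R X -> R).
Proof.
pose Z w := \sum_s' posterior_weight sigma pi0 Wt s' w.
(* The normalizer is positive, so its inverse is [expR (- ln (Z w))], a composition of measurable
   functions. *)
have -> : posterior sigma pi0 Wt s =
    (fun w => posterior_weight sigma pi0 Wt s w * expR (- ln (Z w))).
  apply/funext => w; rewrite expRN lnK//.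
  by rewrite posrE sum_posterior_weight_gt0.
have mw s' : measurable_fun setT
    (posterior_weight sigma pi0 Wt s' : flow_space R X -> R).
  apply: measurable_funM => //; apply: measurableT_comp => //.
  exact: measurable_log_likelihood.
apply: measurable_funM => //; apply: measurableT_comp => //.
apply: measurableT_comp => //; apply: measurableT_comp => //.
exact: measurable_sum.
Qed.

Lemma measurable_posterior_mean (f : S -> flow_space R X -> R) :
  (forall s, measurable_fun setT (f s)) ->
  measurable_fun setT (fun w => posterior_mean sigma pi0 Wt (f ^~ w) w).
Proof.
move=> mf; apply: measurable_sum => s.
by apply: measurable_funM => //; exact: measurable_posterior.
Qed.

Lemma measurable_price (i : X) :
  measurable_fun setT (price sigma pi0 eta Wt i : flow_space R X -> R).
Proof. exact: (measurable_posterior_mean (fun s => cst (eta i s))). Qed.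

(** The covariance formula replaces the derivative by finite sums and products of measurable
    functions. *)
Lemma measurable_price_impact (i j : X) :
  measurable_fun setT (price_impact sigma pi0 eta Wt j i : flow_space R X -> R).
Proof.
have -> : price_impact sigma pi0 eta Wt j i = (fun w =>
    posterior_cov sigma pi0 Wt (eta i) (loglik_slope sigma Wt j ^~ w) w).
  by apply/funext => w; rewrite price_impactE.
have ms s : measurable_fun setT (loglik_slope sigma Wt j s : flow_space R X -> R).
  apply: measurable_fun_ifT => //.
  apply: (@measurable_fun_bool _ _ _ _ true); rewrite setTI.
  rewrite (_ : _ @^-1` _ = [set w : flow_space R X |
      cvgn (enum_series (fun x => Wt x s * w x / sigma x ^+ 2))]).
    by apply: measurable_cvgn => n; exact: measurable_enum_series.
  by apply/seteqP; split => w /= /asboolP.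
apply: (measurable_posterior_mean (fun s w =>
  (eta i s - posterior_mean sigma pi0 Wt (eta i) w) *
  (loglik_slope sigma Wt j s w -
   posterior_mean sigma pi0 Wt (loglik_slope sigma Wt j ^~ w) w))) => s.
apply: measurable_funM; apply: measurable_funB => //.
- exact: (measurable_posterior_mean (fun s => cst (eta i s))).
- exact: measurable_posterior_mean.
Qed.

End measurable_prices.

(** * Differentiation under the expectation *)

Section expected_price_derivative.
Context {R : realType} {d : measure_display} {T : measurableType d}
  {P : probability T R} {X : countType} {S : finType}.
Variables (eps : X -> {RV P >-> R}) (sigma : X -> R) (pi0 : S -> R).
Variables (eta Wt : X -> S -> R).
Hypotheses (pi0_ge0 : forall s, 0 <= pi0 s) (pi0_sum1 : \sum_s pi0 s = 1).

Lemma integrable_bounded_flow (W : X -> R) (f : flow_space R X -> R) (B : R) :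
  measurable_fun setT f -> (forall w, `|f w| <= B) ->
  P.-integrable setT (EFin \o f \o order_flow eps W).
Proof.
move=> mf fB.
apply: (@le_integrable _ _ _ _ setT _ _ (EFin \o cst B)) => //.
- by apply/measurable_EFinP; exact: measurableT_comp.
- by move=> t _; rewrite lee_fin /= (le_trans (fB _))// ler_norm.
- exact: finite_measure_integrable_cst.
Qed.

Lemma expectation_flow_law (W : X -> R) (f : flow_space R X -> R) (B : R) :
  measurable_fun setT f -> (forall w, `|f w| <= B) ->
  ('E_(flow_law eps W)[f] = (\int[P]_t f (order_flow eps W t))%:E)%E.
Proof.
move=> mf fB; have iB := integrable_bounded_flow W f B mf fB.
rewrite unlock /flow_law integral_distribution//; last exact/measurable_EFinP.
by rewrite /Rintegral fineK// integrable_fin_num.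
Qed.

Lemma order_flow_update (W : X -> R) (j : X) (t : R) (y : T) :
  order_flow eps [eta W with j |-> t] y =
  [eta order_flow eps W y with j |-> t + eps j y].
Proof. by apply/funext => x; rewrite /order_flow /=; case: eqP => [->|]. Qed.

(** With the noise fixed, the order placed in [j] is a translate of the coordinate [j] of the flow,
    so the chain rule contributes a factor 1. *)
Lemma is_derive_price_order_flow (W : X -> R) (i j : X) (t : R) (y : T) :
  is_derive t 1
    (fun t => price sigma pi0 eta Wt i (order_flow eps [eta W with j |-> t] y))
    (price_impact sigma pi0 eta Wt j i (order_flow eps [eta W with j |-> t] y)).
Proof.
set w := order_flow eps [eta W with j |-> t] y.
have wj : w j = t + eps j y by rewrite /w order_flow_update /= eqxx.
have dp := is_derive_price sigma pi0 eta Wt pi0_ge0 pi0_sum1 i j w.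
rewrite -(price_impactE sigma pi0 eta Wt pi0_ge0 pi0_sum1) wj in dp.
have ds : is_derive t 1 (fun t : R => t + eps j y) 1.
  by apply: is_derive_eq; rewrite addr0.
have := @is_derive1_comp R _ (fun t : R => t + eps j y) t _ _ dp ds; rewrite mulr1; congr is_derive.
apply/funext => t'; rewrite /= order_flow_update; congr price.
by apply/funext => x; rewrite /w /order_flow /=; case: eqP.
Qed.

(** Pulled back to [T], the expectation is taken under [P], which does not depend on the portfolio;
    only the integrand moves, and its derivative is dominated by a constant. *)
Lemma derive_expected_price (W : X -> R) (i j : X) :
  let F t := expected_price eps sigma pi0 eta Wt i [eta W with j |-> t] in
  [/\ (flow_law eps W).-integrable setT
        (EFin \o price_impact sigma pi0 eta Wt j i),
      derivable F (W j) 1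
    & (('D_1 F (W j))%:E
       = 'E_(flow_law eps W)[price_impact sigma pi0 eta Wt j i])%E].
Proof.
move=> F.
have mp := measurable_price sigma pi0 eta Wt pi0_ge0 pi0_sum1 i.
have mpi := measurable_price_impact sigma pi0 eta Wt pi0_ge0 pi0_sum1 i j.
have bp := price_le sigma pi0 eta Wt pi0_ge0 pi0_sum1 i.
have bpi := price_impact_le sigma pi0 eta Wt pi0_ge0 pi0_sum1 i j.
have W_j : [eta W with j |-> W j] = W :> (X -> R).
  by apply/funext => x /=; case: eqP => [->|].
pose f t y := price sigma pi0 eta Wt i (order_flow eps [eta W with j |-> t] y).
have FE : F = fun t => \int[P]_(y in setT) f t y.
  by apply/funext => t; rewrite /F /expected_price (expectation_flow_law _ _ _ mp bp).
have d1f t y : partial1of2 f t y =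
    price_impact sigma pi0 eta Wt j i (order_flow eps [eta W with j |-> t] y).
  by rewrite partial1of2E; have [_ ->] := is_derive_price_order_flow W i j t y.
(* The radius 1 is arbitrary, because the dominating constant is global. *)
have Ia : `]W j - 1, W j + 1[%classic (W j).
  by rewrite /= in_itv /= ltrBlDr ltrDl ltr01.
have intf t : `]W j - 1, W j + 1[%classic t -> P.-integrable setT (EFin \o f t).
  by move=> _; exact: integrable_bounded_flow mp bp.
have derf t y : `]W j - 1, W j + 1[%classic t -> [set: T] y ->
    derivable (f ^~ y) t 1.
  by move=> _ _; have [] := is_derive_price_order_flow W i j t y.
have G0 (y : T) : 0 <= price_impact_bound sigma eta Wt i j.
  exact: le_trans (bpi (order_flow eps W y)).
have intG : P.-integrable setT (EFin \o cst (price_impact_bound sigma eta Wt i j)).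
  exact: finite_measure_integrable_cst.
have G_ub t y : `]W j - 1, W j + 1[%classic t -> [set: T] y ->
    `|partial1of2 f t y| <= price_impact_bound sigma eta Wt i j.
  by move=> _ _; rewrite d1f.
split.
- apply: (@le_integrable _ _ _ _ setT _ _
    (EFin \o cst (price_impact_bound sigma eta Wt i j))) => //.
  + exact/measurable_EFinP.
  + by move=> w _; rewrite lee_fin /= (le_trans (bpi _))// ler_norm.
  + exact: finite_measure_integrable_cst.
- rewrite FE.
  exact: (derivable_under_integral measurableT Ia intf derf G0 intG G_ub).
- have F'E : 'D_1 F (W j) =
      \int[P]_y price_impact sigma pi0 eta Wt j i (order_flow eps W y).
    rewrite -derive1E FE (differentiation_under_integral measurableT Ia intf derf G0 intG G_ub).
    by apply: eq_Rintegral => y _; rewrite d1f W_j.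
  by rewrite (expectation_flow_law _ _ _ mpi bpi) F'E.
Qed.

End expected_price_derivative.

(** * Symmetry and second moment of the centered normal law *)

Section normal_moments.
Context {R : realType}.
Local Notation mu := (@lebesgue_measure R).

Lemma normal_probN (s : R) (B : set R) : s != 0 -> measurable B ->
  normal_prob 0 s (-%R @^-1` B) = normal_prob 0 s B.
Proof.
move=> s0 mB; rewrite /normal_prob.
transitivity (\int[pushforward mu (-%R : _ -> measurableTypeR R)]_(x in B)
    (normal_pdf 0 s x)%:E)%E.
  rewrite ge0_integral_pushforward//=.
  - apply: eq_integral => x _.
    by rewrite /= !normal_pdfE// /normal_fun !subr0 sqrrN.
  - by apply/measurable_EFinP/measurable_funTS; exact: measurable_normal_pdf.
  - by move=> x _; rewrite lee_fin normal_pdf_ge0.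
by apply: eq_measure_integral => A mA _; exact: lebesgue_measureN.
Qed.

(** The Radon-Nikodym derivative and [normal_pdf] have the same integral over every measurable set,
    hence agree almost everywhere. *)
Lemma ge0_integral_normal_prob (m s : R) (f : R -> \bar R) :
  measurable_fun setT f -> (forall x, (0 <= f x)%E) ->
  (\int[normal_prob m s]_x f x = \int[mu]_x (f x * (normal_pdf m s x)%:E))%E.
Proof.
move=> mf f0; have dom := normal_prob_dominates m s.
rewrite -(Radon_Nikodym_SigmaFinite.change_of_variables dom)//.
have iRN := Radon_Nikodym_SigmaFinite.f_integrable dom.
have mpdf : measurable_fun setT (EFin \o normal_pdf m s).
  by apply/measurable_EFinP; exact: measurable_normal_pdf.
apply: ae_eq_integral => //.
- by apply: emeasurable_funM => //; exact: measurable_int iRN.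
- exact: emeasurable_funM.
- apply: ae_eqe_mul2l; apply: integral_ae_eq => // E _ mE.
  by rewrite -Radon_Nikodym_SigmaFinite.f_integral.
Qed.

(* With u = y^2 / (4 s^2), the bound y^2 <= 4 s^2 exp u turns the density of
   standard deviation s into that of standard deviation sqrt 2 * s. *)
Lemma normal_second_moment_le (s : R) : s != 0 ->
  (\int[normal_prob 0 s]_y (y ^+ 2)%:E <= (4 * Num.sqrt 2 * s ^+ 2)%:E)%E.
Proof.
move=> s0; rewrite ge0_integral_normal_prob//; last first.
- by move=> x; rewrite lee_fin sqr_ge0.
- by apply/measurable_EFinP; exact: measurable_funX.
pose s' : R := Num.sqrt 2 * s.
have s'0 : s' != 0 by rewrite mulf_neq0// gt_eqF// sqrtr_gt0.
have c0 : 0 <= 4 * Num.sqrt 2 * s ^+ 2 by rewrite mulr_ge0 ?sqr_ge0// mulr_ge0 ?sqrtr_ge0.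
rewrite -[leRHS]mule1 -(integral_normal_pdf 0 s') -ge0_integralZl//; last 2 first.
- by apply/measurable_EFinP; exact: measurable_normal_pdf.
- by move=> x _; rewrite lee_fin normal_pdf_ge0.
apply: ge0_le_integral => //.
- by move=> x _; rewrite -EFinM lee_fin mulr_ge0 ?sqr_ge0 ?normal_pdf_ge0.
- apply/measurable_EFinP/measurable_funM; first exact: measurable_funX.
  exact: measurable_normal_pdf.
- apply/measurable_EFinP/measurable_funM => //; exact: measurable_normal_pdf.
move=> y _; rewrite -!EFinM lee_fin !normal_pdfE// /normal_fun !subr0.
have s'2 : s' ^+ 2 = 2 * s ^+ 2 by rewrite exprMn sqr_sqrtr.
(* The peak is inversely proportional to the standard deviation; this is the source of the factor
   [Num.sqrt 2] in the bound. *)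
have peakE : normal_peak s = Num.sqrt 2 * normal_peak s'.
  have -> : normal_peak s' = (Num.sqrt (2 * (s ^+ 2 * pi *+ 2)))^-1.
    by rewrite /normal_peak s'2; congr (Num.sqrt _)^-1; ring.
  by rewrite sqrtrM// invfM mulrA divff ?mul1r// gt_eqF// sqrtr_gt0.
rewrite peakE s'2; set u := y ^+ 2 / (4 * s ^+ 2).
have -> : - y ^+ 2 / (s ^+ 2 *+ 2) = - u - u by rewrite /u; field.
have -> : - y ^+ 2 / (2 * s ^+ 2 *+ 2) = - u by rewrite /u; field.
have y2 : y ^+ 2 = 4 * s ^+ 2 * u by rewrite /u; field.
rewrite expRD.
have uexp : u * expR (- u) <= 1.
  rewrite expRN ler_pdivrMr ?expR_gt0// mul1r.
  by apply: le_trans (expR_ge1Dx u); rewrite lerDr.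
have -> : y ^+ 2 * (Num.sqrt 2 * normal_peak s' * (expR (- u) * expR (- u))) =
  (4 * Num.sqrt 2 * s ^+ 2 * (normal_peak s' * expR (- u))) * (u * expR (- u)).
  by rewrite {1}y2; ring.
by rewrite ler_piMr// mulr_ge0// mulr_ge0 ?expR_ge0 ?normal_peak_ge0.
Qed.

End normal_moments.

(** * Almost sure convergence of series with sign-symmetric terms *)

Section symmetric_series.
Context {R : realType} {d : measure_display} {T : measurableType d}.
Variables (Q : {measure set T -> \bar R}) (u : (T -> R)^nat) (phi : nat -> T -> T).
Hypothesis mu_ : forall n, measurable_fun setT (u n).
Hypothesis mphi : forall n, measurable_fun setT (phi n).
Hypothesis phiQ : forall n A, measurable A -> Q (phi n @^-1` A) = Q A.
Hypothesis u_phi : forall n t, u n (phi n t) = - u n t.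
Hypothesis u_phi_lt : forall m n t, (m < n)%N -> u m (phi n t) = u m t.

Let increment (b : R) (M : T -> R) (n : nat) (t : T) : R :=
  if `|M t| < b then u n t else 0.

(** The sum of [n] terms starting at index [N], frozen as soon as its absolute value reaches [b]. *)
Fixpoint stopped_sum (b : R) (N n : nat) (t : T) : R :=
  if n is n'.+1 then
    stopped_sum b N n' t + increment b (stopped_sum b N n') (N + n') t
  else 0.

Let measurable_increment b M n : measurable_fun setT M ->
  measurable_fun setT (increment b M n).
Proof.
move=> mM; apply: measurable_fun_ifT => //.
by apply: measurable_fun_ltr => //; exact: measurableT_comp.
Qed.

Lemma measurable_stopped_sum b N n : measurable_fun setT (stopped_sum b N n).
Proof.
elim: n => [|n IH] /=; first exact: measurable_cst.
by apply: measurable_funD => //; exact: measurable_increment.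
Qed.

(** Only terms of index below [N + n] enter, the stopping tests included, and [phi (N + k)] fixes
    them all. *)
Lemma stopped_sum_phi b N n k t : (n <= k)%N ->
  stopped_sum b N n (phi (N + k) t) = stopped_sum b N n t.
Proof.
elim: n => [//|n IH] nk /=; have nk' := ltnW nk.
by rewrite /increment IH// u_phi_lt// ltn_add2l.
Qed.

Lemma integral_phi n (f : T -> \bar R) : measurable_fun setT f ->
  (forall t, 0 <= f t)%E -> (\int[Q]_t f (phi n t) = \int[Q]_t f t)%E.
Proof.
move=> mf f0; transitivity (\int[pushforward Q (phi n)]_t f t)%E.
  by rewrite ge0_integral_pushforward.
by apply: eq_measure_integral => A mA _; exact: phiQ.
Qed.

(* Reversing the sign of the next term turns (M + Y)^2 into (M - Y)^2, so the
   cross term integrates to 0 without any integrability assumption. *)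
Lemma integral_sqr_stopped_sumS b N n :
  (\int[Q]_t (stopped_sum b N n.+1 t ^+ 2)%:E <=
   \int[Q]_t (stopped_sum b N n t ^+ 2)%:E + \int[Q]_t (u (N + n) t ^+ 2)%:E)%E.
Proof.
set M := stopped_sum b N n; set Y := increment b M (N + n).
have mM : measurable_fun setT M := measurable_stopped_sum b N n.
have mY : measurable_fun setT Y by exact: measurable_increment.
have msqr (f : T -> R) : measurable_fun setT f ->
    measurable_fun setT (fun t : T => (f t ^+ 2 : R)%:E).
  by move=> mf; apply/measurable_EFinP; exact: measurable_funX.
(* Half of the square: the integral is split into two copies of [f], and the sign change is applied
   to one of them. *)
pose f t : \bar R := (2^-1 * (M t + Y t) ^+ 2)%:E.
have mf : measurable_fun setT f.
  apply/measurable_EFinP; apply: measurable_funM => //.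
  by apply: measurable_funX; exact: measurable_funD.
have f0 t : (0 <= f t)%E by rewrite lee_fin mulr_ge0 ?sqr_ge0.
have -> : (\int[Q]_t (stopped_sum b N n.+1 t ^+ 2)%:E =
    \int[Q]_t (M t ^+ 2)%:E + \int[Q]_t (Y t ^+ 2)%:E)%E.
  transitivity (\int[Q]_t (f t + f t))%E.
    by apply: eq_integral => t _; rewrite -EFinD /= -/M -/Y; congr EFin; field.
  rewrite ge0_integralD// -{2}(integral_phi (N + n))//.
  rewrite -ge0_integralD//; last exact: measurableT_comp.
  rewrite -ge0_integralD//; last 4 first.
  - by move=> t _; rewrite lee_fin sqr_ge0.
  - exact: msqr.
  - by move=> t _; rewrite lee_fin sqr_ge0.
  - exact: msqr.
  apply: eq_integral => t _; rewrite -!EFinD; congr EFin.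
  have -> : M (phi (N + n) t) = M t by exact: stopped_sum_phi.
  have -> : Y (phi (N + n) t) = - Y t.
    rewrite /Y /increment (_ : M (phi (N + n) t) = M t) ?u_phi.
      by case: ifP; rewrite ?oppr0.
    exact: stopped_sum_phi.
  by field.
(* The increment is either the term of [u] or 0, so stopping can only decrease its square. *)
apply: leeD => //; apply: ge0_le_integral => //.
- by move=> t _; rewrite lee_fin sqr_ge0.
- exact: msqr.
- exact: msqr.
move=> t _; rewrite lee_fin /Y /increment; case: ifP => // _.
by rewrite expr0n sqr_ge0.
Qed.

Let v (n : nat) : \bar R := (\int[Q]_t (u n t ^+ 2)%:E)%E.

Let v_ge0 n : (0 <= v n)%E.
Proof. by apply: integral_ge0 => t _; rewrite lee_fin sqr_ge0. Qed.

Lemma integral_sqr_stopped_sum b N n :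
  (\int[Q]_t (stopped_sum b N n t ^+ 2)%:E <= \sum_(N <= k <oo) v k)%E.
Proof.
apply: (@le_trans _ _ (\sum_(N <= k < N + n) v k)%E).
  elim: n => [|n IH].
    by rewrite addn0 big_geq//= expr0n integral0.
  rewrite addnS big_nat_recr ?leq_addr//=.
  by apply: le_trans (integral_sqr_stopped_sumS _ _ _) _; exact: leeD.
exact: nneseries_lim_ge.
Qed.

Let exceed (b : R) (N n : nat) : set T := [set t | b <= `|stopped_sum b N n t|].

Let measurable_exceed b N n : measurable (exceed b N n).
Proof.
rewrite /exceed -[X in measurable X]setTI; apply: measurable_fun_le => //.
by apply: measurableT_comp => //; exact: measurable_stopped_sum.
Qed.

(** Chebyshev's inequality for the stopped sum. *)
Let exceed_le b N n : 0 < b ->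
  ((b ^+ 2)%:E * Q (exceed b N n) <= \sum_(N <= k <oo) v k)%E.
Proof.
move=> b0; apply: le_trans (integral_sqr_stopped_sum b N n).
have mM : measurable_fun setT (fun t => (stopped_sum b N n t ^+ 2)%:E).
  apply/measurable_EFinP; apply: measurable_funX; exact: measurable_stopped_sum.
have M0 t : (0 <= (stopped_sum b N n t ^+ 2)%:E)%E by rewrite lee_fin sqr_ge0.
rewrite -integral_cst//.
apply: (@le_trans _ _ (\int[Q]_(t in exceed b N n) (stopped_sum b N n t ^+ 2)%:E)%E).
  apply: ge0_le_integral => //.
  - by move=> t _; rewrite lee_fin sqr_ge0.
  - exact: measurable_funTS.
  move=> t; rewrite /exceed /= lee_fin => bt.
  by rewrite -[leRHS]real_normK ?num_real// lerXn2r ?nnegrE// ltW.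
exact: ge0_subset_integral.
Qed.

(** A sum frozen at or above [b] in absolute value stays there, so the events increase with [n] and
    continuity from below passes the bound to their union. This is the maximal inequality. *)
Let bigcup_exceed_le b N : 0 < b ->
  ((b ^+ 2)%:E * Q (\bigcup_n exceed b N n) <= \sum_(N <= k <oo) v k)%E.
Proof.
move=> b0.
have nd : {homo exceed b N : n m / (n <= m)%N >-> (n <= m)%O}.
  apply: homo_leq => [//||n].
  - by move=> A B C; exact: le_trans.
  - apply/subsetPset => t; rewrite /exceed /= => bt.
    by rewrite /increment ltNge bt /= addr0.
have mB := bigcupT_measurable _ (measurable_exceed b N).
have cQ := nondecreasing_cvg_mu (mu := Q) (measurable_exceed b N) mB nd.
have b2 : (0 < (b ^+ 2)%:E)%E by rewrite lte_fin exprn_gt0.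
rewrite muleC -lee_pdivlMr//.
apply: (cvge_to_le cQ).
apply: nearW => n /=; rewrite lee_pdivlMr// muleC; exact: exceed_le.
Qed.

Lemma ae_cvgn_symmetric_series : (\sum_(0 <= k <oo) v k < +oo)%E ->
  {ae Q, forall t, cvgn (series (u ^~ t))}.
Proof.
move=> voo.
(* The points where, from every starting index, the sums move by at least [p.+1%:R^-1]. Its measure
   is controlled by tails of a summable series; off all the [D p] the partial sums are Cauchy. *)
pose D p := \bigcap_N \bigcup_n exceed (p.+1%:R^-1) N n.
have mD p : measurable (D p).
  by apply: bigcapT_measurable => N; exact: bigcupT_measurable.
have D0 p : Q (D p) = 0%E.
  have b0 : 0 < (p.+1%:R^-1 : R) by rewrite invr_gt0.
  apply/eqP; rewrite -measure_le0.
  have b2 : (0 < ((p.+1%:R^-1 : R) ^+ 2)%:E)%E by rewrite lte_fin exprn_gt0.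
  rewrite -(@pmule_rle0 _ ((p.+1%:R^-1 : R) ^+ 2)%:E)//.
  have tail0 := nneseries_tail_cvg voo (fun k _ => v_ge0 k).
  apply: (cvge_to_ge tail0); apply: nearW => N.
  apply: le_trans (bigcup_exceed_le _ N b0).
  rewrite lee_pmul2l//; apply: le_measure; rewrite ?inE//.
    exact: bigcupT_measurable.
  by move=> t; apply.
apply: (@negligibleS _ _ _ _ (\bigcup_p D p)); last first.
  by apply: negligible_bigcup => p; exists (D p); split.
apply: subsetCl; rewrite setC_bigcup => t nD /=; apply/cvgn_cauchyP => p.
have [N hN] : exists N, forall n, ~ exceed (p.+1%:R^-1) N n t.
  apply: contrapT => h; apply: (nD p I) => N _; apply: contrapT => hN.
  by apply: h; exists N => n e; apply: hN; exists n.
have lt_stopped n : `|stopped_sum p.+1%:R^-1 N n t| < p.+1%:R^-1.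
  by rewrite ltNge; apply/negP; exact: hN.
(* The threshold is never reached from [N] on, so the stopped sum is the actual difference of
   partial sums. *)
have seriesE n : series (u ^~ t) (N + n)%N =
    series (u ^~ t) N + stopped_sum p.+1%:R^-1 N n t.
  elim: n => [|n IH]; first by rewrite addn0 /= addr0.
  rewrite addnS [LHS]big_nat_recr//= -[X in X + _]/(series (u ^~ t) (N + n)%N).
  by rewrite IH -addrA /increment lt_stopped.
by exists N => n; rewrite seriesE addrC addKr.
Qed.

End symmetric_series.

(** * Convergence of enumerated sums under finite energy *)

Section enum_sum_convergence.
Context {R : realType} {X : countType}.
Implicit Types (f g : X -> R) (F : X -> \bar R).

(** The coding is a bijection onto its range, the indices outside the range add 0, and nonnegative
    sums do not depend on the order. *)
Lemma nneseries_pickle_inv F : (forall x, 0 <= F x)%E ->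
  (\sum_(0 <= k <oo) oapp F 0 (@pickle_inv X k) = \esum_(x in [set: X]) F x)%E.
Proof.
move=> F0.
have a0 k : (0 <= oapp F 0 (@pickle_inv X k))%E by case: pickle_inv.
rewrite nneseries_esumT//.
have bij : set_bij [set: X] (range (@choice.pickle X)) (@choice.pickle X) by split.
transitivity (\esum_(k in range (@choice.pickle X)) oapp F 0 (@pickle_inv X k))%E.
  rewrite [RHS]esum_mkcond; apply: eq_esum => k _.
  case: ifPn => //; rewrite notin_setE => kX.
  case E : (pickle_inv k) => [x|]//=; exfalso; apply: kX.
  by exists x => //; have := @pickle_invK X k; rewrite E.
rewrite (reindex_esum _ _ _ _ bij).
by apply: eq_esum => x _; rewrite pickleK_inv.
Qed.

Lemma is_cvg_enum_series f : (forall x, 0 <= f x) ->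
  (\esum_(x in [set: X]) (f x)%:E < +oo)%E -> cvgn (enum_series f).
Proof.
move=> f0; rewrite -nneseries_pickle_inv// => foo.
have t0 k : 0 <= oapp f 0 (@pickle_inv X k) by case: pickle_inv.
have tE k : oapp (fun x => (f x)%:E) 0%E (@pickle_inv X k) =
    (oapp f 0 (@pickle_inv X k))%:E by case: pickle_inv.
set l := limn _ in foo.
have l0 : (0 <= l)%E by apply: nneseries_ge0 => k _ _; rewrite tE lee_fin.
have lfin : l \is a fin_num by rewrite ge0_fin_numE.
apply: nondecreasing_is_cvgn.
  by apply: nondecreasing_series => k _ _.
exists (fine l) => _ [n _ <-].
rewrite -lee_fin fineK// /enum_series -sumEFin.
under eq_bigr do rewrite -tE.
by apply: nneseries_lim_ge => k _ _; rewrite tE lee_fin.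
Qed.

(** Absolute convergence by comparison, using that [|V x * W x|] is at most
    [W x ^+ 2 + V x ^+ 2]. *)
Lemma is_cvg_enum_series_prod (sigma W V : X -> R) :
  finite_energy sigma W -> finite_energy sigma V ->
  cvgn (enum_series (fun x => V x * W x / sigma x ^+ 2)).
Proof.
move=> fW fV.
have sq0 (U : X -> R) x : 0 <= U x ^+ 2 / sigma x ^+ 2 by rewrite divr_ge0 ?sqr_ge0.
have cW : cvgn (enum_series (fun x => W x ^+ 2 / sigma x ^+ 2)).
  exact: is_cvg_enum_series.
have cV : cvgn (enum_series (fun x => V x ^+ 2 / sigma x ^+ 2)).
  exact: is_cvg_enum_series.
have cWV : cvgn (enum_series (fun x =>
    W x ^+ 2 / sigma x ^+ 2 + V x ^+ 2 / sigma x ^+ 2)).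
  by rewrite enum_seriesD; exact: is_cvgD.
apply: normed_cvg; apply: (series_le_cvg _ _ _ cWV) => k /=.
- exact: normr_ge0.
- by case: pickle_inv => //= x; rewrite addr_ge0.
case: pickle_inv => [x|] /=; last by rewrite normr0.
rewrite !normrM -mulrDl (ger0_norm (_ : 0 <= (sigma x ^+ 2)^-1)); last first.
  by rewrite invr_ge0 sqr_ge0.
rewrite ler_wpM2r ?invr_ge0 ?sqr_ge0// -(real_normK (num_real (W x))).
rewrite -(real_normK (num_real (V x))).
have := sqr_ge0 (`|W x| - `|V x|).
have := mulr_ge0 (normr_ge0 (W x)) (normr_ge0 (V x)); nra.
Qed.

End enum_sum_convergence.

(** * Sign changes of coordinates and uniqueness of measures on flows *)

Section coordinate_flip.
Context {R : realType} {X : countType}.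

Definition flip (j : X) (w : flow_space R X) : flow_space R X :=
  fun x => if x == j then - w x else w x.

Lemma measurable_flip (j : X) : measurable_fun setT (flip j).
Proof.
apply: (@measurability _ _ (flow_space R X) (flow_space R X) setT (flip j)
  (cylinders R X) erefl).
move=> _ [_ [x [B [mB ->]]] <-].
suff mf : measurable_fun setT (fun w : flow_space R X => flip j w x) by exact: mf.
rewrite /flip; case: eqP => _; last exact: measurable_coordinate.
by apply: measurableT_comp => //; exact: measurable_coordinate.
Qed.

HB.instance Definition _ j := isMeasurableFun.Build _ _ _ _ (flip j) (measurable_flip j).

(** Constraints on finitely many coordinates: the sets on which mutual independence evaluates the
    noise law, and a pi-system generating the product sigma-algebra. *)
Definition rectangle (F : {fset X}) (B : X -> set R) : set (flow_space R X) :=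
  \bigcap_(x in [set` F]) ((fun w : flow_space R X => w x) @^-1` B x).

Definition rectangles : set (set (flow_space R X)) :=
  [set A | exists F B, (forall x, measurable (B x)) /\ A = rectangle F B].

Lemma measurable_rectangles : rectangles `<=` measurable.
Proof.
move=> _ [F [B [mB ->]]]; apply: fin_bigcap_measurable => [|x _].
  exact: finite_fset.
by rewrite -[X in measurable X]setTI; exact: measurable_coordinate.
Qed.

Lemma setI_closed_rectangles : setI_closed rectangles.
Proof.
move=> _ _ [F [B [mB ->]]] [G [C [mC ->]]].
(* Padding by [setT] brings both rectangles to the common index set, the union of [F] and [G]. *)
pose BF x := if x \in F then B x else setT.
pose CG x := if x \in G then C x else setT.
exists (F `|` G)%fset, (fun x => BF x `&` CG x); split.
  by move=> x; apply: measurableI; rewrite /BF /CG; case: ifP.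
apply/seteqP; split => w /=.
  move=> [wF wG] x _; split; rewrite /BF /CG; case: ifP => // xFG.
    exact: wF.
  exact: wG.
move=> wFG; split => x xFG.
  have [|/= + _] := wFG x; first by rewrite /= in_fsetU; apply/orP; left.
  by rewrite /BF ifT.
have [|/= _] := wFG x; first by rewrite /= in_fsetU; apply/orP; right.
by rewrite /CG ifT.
Qed.

Lemma flow_measure_unique (m1 m2 : probability (flow_space R X) R) :
  (forall A, rectangles A -> m1 A = m2 A) ->
  forall A, measurable A -> m1 A = m2 A.
Proof.
move=> m12 A mA.
apply: (@g_sigma_algebra_measure_unique _ _ _ rectangles _ (fun=> setT)) => //.
- exact: measurable_rectangles.
- move=> _; exists fset0, (fun=> setT); split => //.
  by apply/seteqP; split => // w _ x.
- by rewrite bigcup_const//; exists 0%N.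
- exact: setI_closed_rectangles.
- by move=> k; rewrite ltey_eq fin_num_measure.
- move: mA; apply: sub_sigma_algebra2 => _ [x [B [mB ->]]].
  exists [fset x]%fset, (fun=> B); split => //.
  apply/seteqP; split => w /=; first by move=> wB y; rewrite /= inE => /eqP ->.
  by apply; rewrite /= inE.
Qed.

End coordinate_flip.

(** * The posterior is defined almost surely under Gaussian noise *)

Section gaussian_flow.
Context {R : realType} {d : measure_display} {T : measurableType d}
  {P : probability T R} {X : countType}.
Variables (sigma : X -> R) (eps : X -> {RV P >-> R}).
Hypothesis sigma_gt0 : forall x, 0 < sigma x.
Hypothesis eps_noise : gaussian_noise sigma eps.

(** With the zero portfolio the order flow is the noise alone. *)
Let Q : probability (flow_space R X) R := flow_law eps (fun=> 0).

(** It suffices to compare on rectangles. There a flip reflects the factor at [j], independence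
    turns the probability into a product, and the centered normal law is symmetric. *)
Lemma noise_law_flip (j : X) (A : set (flow_space R X)) : measurable A ->
  Q (flip j @^-1` A) = Q A.
Proof.
move=> mA; have [indep law] := eps_noise.
apply: (flow_measure_unique (distribution Q (flip j)) Q) mA => _ [F [B [mB ->]]].
have rectE C : (forall x, measurable (C x)) ->
    Q (rectangle F C) = (\prod_(x <- F) P (eps x @^-1` C x))%E.
  move=> mC; rewrite -indep//; congr (P _).
  by apply/seteqP; split => t /= h x xF; have := h x xF;
    rewrite /= /order_flow add0r.
pose B' x := if x == j then -%R @^-1` B x else B x.
have mN x : measurable (-%R @^-1` B x).
  have mopp : measurable_fun setT (fun y : R => - y) by exact: measurable_funN.
  by rewrite -[X in measurable X]setTI; exact: mopp.
have mB' x : measurable (B' x) by rewrite /B'; case: eqP.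
rewrite [RHS]rectE//; transitivity (Q (rectangle F B')).
  congr (Q _); apply/seteqP; split => w /= h x xF; have := h x xF;
    by rewrite /= /flip /B'; case: eqP.
rewrite rectE//; apply: eq_bigr => x _; rewrite /B'; case: eqP => // _.
rewrite -[LHS]/(distribution P (eps x) _) -[RHS]/(distribution P (eps x) _).
by rewrite !law ?normal_probN ?gt_eqF//; exact: mN.
Qed.

Lemma noise_second_moment_le (x : X) :
  (\int[Q]_w (w x ^+ 2)%:E <= (4 * Num.sqrt 2 * sigma x ^+ 2)%:E)%E.
Proof.
have [_ law] := eps_noise.
have msq : measurable_fun setT (fun y : R => (y ^+ 2)%:E).
  by apply/measurable_EFinP; exact: measurable_funX.
have -> : (\int[Q]_w (w x ^+ 2)%:E = \int[normal_prob 0 (sigma x)]_y (y ^+ 2)%:E)%E.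
  rewrite /Q /flow_law ge0_integral_distribution//; last 2 first.
  - by apply: (measurableT_comp msq); exact: measurable_coordinate.
  - by move=> w; rewrite lee_fin sqr_ge0.
  (* The library's two copies of the Borel sigma-algebra on R carry different
     displays, hence the explicit target type. *)
  pose e : T -> measurableTypeR R := eps x.
  have me : measurable_fun setT e by exact: (@measurable_funPT _ _ _ _ (eps x)).
  transitivity (\int[pushforward P e]_y (y ^+ 2)%:E)%E.
    rewrite ge0_integral_pushforward//; last by move=> y _; rewrite lee_fin sqr_ge0.
    by apply: eq_integral => t _; rewrite /= /order_flow add0r.
  by apply: eq_measure_integral => A mA _; exact: law.
by apply: normal_second_moment_le; rewrite gt_eqF.
Qed.

(** The symmetric series theorem applies with coordinate flips as sign changes: the term at [x] has
    second moment at most a constant times [V x ^+ 2 / sigma x ^+ 2], which is summable by finite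
    energy. *)
Lemma ae_cvgn_noise_series (V : X -> R) : finite_energy sigma V ->
  {ae Q, forall w, cvgn (enum_series (fun x => V x * w x / sigma x ^+ 2))}.
Proof.
move=> Vfin; pose f (w : flow_space R X) x := V x * w x / sigma x ^+ 2.
pose u k (w : flow_space R X) : R := oapp (f w) 0 (@pickle_inv X k).
(* At an index that codes no claim the term is 0, so the identity already changes its sign. *)
pose phi k : flow_space R X -> flow_space R X :=
  if @pickle_inv X k is Some x then flip x else id.
pose C : R := 4 * Num.sqrt 2.
have C0 : 0 <= C by rewrite mulr_ge0 ?sqrtr_ge0.
have V0 x : (0 <= (V x ^+ 2 / sigma x ^+ 2)%:E)%E.
  by rewrite lee_fin divr_ge0 ?sqr_ge0.
have muk k : measurable_fun setT (u k).
  rewrite /u; case: pickle_inv => [x|] //=.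
  by apply: measurable_funM => //; apply: measurable_funM => //;
    exact: measurable_coordinate.
apply: (@ae_cvgn_symmetric_series _ _ _ Q u phi) => //.
- by move=> k; rewrite /phi; case: pickle_inv => // x; exact: measurable_flip.
- move=> k A mA; rewrite /phi; case: pickle_inv => // x; exact: noise_law_flip.
- move=> k w; rewrite /u /phi; case: pickle_inv => [x|] /=; last by rewrite oppr0.
  by rewrite /f /flip eqxx mulrN mulNr.
- move=> m k w mk; rewrite /u /phi.
  case: (pickle_inv m) (@pickle_invK X m) => //= y ym.
  case: (pickle_inv k) (@pickle_invK X k) => //= x xk.
  by rewrite /f /flip; case: eqP => // yx; move: mk; rewrite -ym -xk yx ltnn.
pose F k := oapp (fun x => (V x ^+ 2 / sigma x ^+ 2)%:E) 0%E (@pickle_inv X k).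
have F0 k : (0 <= F k)%E by rewrite /F; case: pickle_inv.
apply: (@le_lt_trans _ _ (\sum_(0 <= k <oo) C%:E * F k)%E).
  apply: lee_nneseries => [k _ _|k _].
    by apply: integral_ge0 => w _; rewrite lee_fin sqr_ge0.
  rewrite /u /F; case: pickle_inv => [x|] /=; last first.
    by rewrite mule0 expr0n integral0.
  have s0 : sigma x != 0 by rewrite gt_eqF.
  pose c := (V x / sigma x ^+ 2) ^+ 2.
  have -> : (\int[Q]_w (f w x ^+ 2)%:E = c%:E * \int[Q]_w (w x ^+ 2)%:E)%E.
    rewrite -ge0_integralZl//.
    - by apply: eq_integral => w _; rewrite -EFinM /f /c; congr EFin; ring.
    - apply/measurable_EFinP; apply: measurable_funX; exact: measurable_coordinate.
    - by move=> w _; rewrite lee_fin sqr_ge0.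
    - by rewrite lee_fin sqr_ge0.
  apply: (@le_trans _ _ (c%:E * (C * sigma x ^+ 2)%:E)%E).
    by apply: lee_wpmul2l; [rewrite lee_fin sqr_ge0|exact: noise_second_moment_le].
  by rewrite -!EFinM lee_fin /c le_eqVlt; apply/orP; left; apply/eqP; field.
rewrite nneseriesZl// nneseries_pickle_inv//.
by rewrite lte_mul_pinfty// lee_fin.
Qed.

Context {S : finType}.
Variable Wt : X -> S -> R.
Hypothesis Wt_fin : forall s, finite_energy sigma (Wt ^~ s).

Lemma posterior_defined_shift (W w : X -> R) : finite_energy sigma W ->
  posterior_defined sigma Wt w ->
  posterior_defined sigma Wt (fun x => W x + w x).
Proof.
move=> Wfin wd s.
rewrite (_ : (fun x => _) = (fun x => Wt x s * W x / sigma x ^+ 2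
    + Wt x s * w x / sigma x ^+ 2)); last first.
  by apply/funext => x; rewrite mulrDr mulrDl.
rewrite enum_seriesD; apply: is_cvgD; last exact: wd.
exact: is_cvg_enum_series_prod.
Qed.

(** The portfolio shifts each likelihood series by a convergent one. Noise outcomes with undefined
    posterior under [W] are therefore among those undefined for pure noise, a null event. *)
Lemma ae_posterior_defined (W : X -> R) : finite_energy sigma W ->
  {ae flow_law eps W, forall w, posterior_defined sigma Wt w}.
Proof.
move=> Wfin.
have aeQ : {ae Q, forall w, posterior_defined sigma Wt w}.
  by apply: filter_forall => s; exact: ae_cvgn_noise_series.
pose D := ~` [set w : flow_space R X | posterior_defined sigma Wt w].
have mD : measurable D by apply: measurableC; exact: measurable_posterior_defined.
exists D; split => //.
have QD0 : Q D = 0%E by apply/negligibleP.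
have mo V : measurable (order_flow eps V @^-1` D).
  by rewrite -[X in measurable X]setTI; exact: measurable_order_flow.
apply: (@subset_measure0 _ _ _ P _ (order_flow eps (fun=> 0) @^-1` D)) QD0;
  [exact: mo|exact: mo|].
move=> t; apply: contra_not => /= /(posterior_defined_shift _ _ Wfin).
by congr posterior_defined; apply/funext => x; rewrite /order_flow add0r.
Qed.

End gaussian_flow.

Theorem corollary5p2 (R : realType) (d : measure_display)
  (T : measurableType d) (P : probability T R)
  (X : countType) (S : finType)
  (sigma : X -> R) (pi0 : S -> R) (eta : X -> S -> R)
  (eps : X -> {RV P >-> R}) (W : X -> R) (Wt : X -> S -> R)
  (sigma_gt0 : forall x, 0 < sigma x)
  (pi0_ge0 : forall s, 0 <= pi0 s)
  (pi0_sum1 : \sum_s pi0 s = 1)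
  (eta_ge0 : forall x s, 0 <= eta x s)
  (eta_sum1 : forall s, (\esum_(x in [set: X]) (eta x s)%:E = 1)%E)
  (eps_noise : gaussian_noise sigma eps)
  (W_fin : finite_energy sigma W)
  (Wt_fin : forall s, finite_energy sigma (Wt ^~ s)) :
  [/\ {ae flow_law eps W, forall w, posterior_defined sigma Wt w},
      forall (i j : X) (w : X -> R), posterior_defined sigma Wt w ->
        is_derive (w j) 1
          (fun t : R => price sigma pi0 eta Wt i [eta w with j |-> t])
          ((sigma j ^+ 2)^-1
             * posterior_cov sigma pi0 Wt (eta i) (Wt j) w)
    & forall i j : X,
        [/\ (flow_law eps W).-integrable setT
              (EFin \o price_impact sigma pi0 eta Wt j i),
            derivable
              (fun t : R =>
                 expected_price eps sigma pi0 eta Wt i [eta W with j |-> t])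
              (W j) 1
          & (('D_1 (fun t : R =>
                expected_price eps sigma pi0 eta Wt i [eta W with j |-> t])
                (W j))%:E
             = 'E_(flow_law eps W)[price_impact sigma pi0 eta Wt j i])%E]].
Proof.
split.
- exact: (ae_posterior_defined sigma eps sigma_gt0 eps_noise Wt Wt_fin W W_fin).
- by move=> i j w; exact: is_derive_price_defined.
- by move=> i j; exact: derive_expected_price.
Qed.
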